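(* Let $\theta\in\mathtt{S}=\{0,1,\nu,2\nu,3\nu,2+\nu,2+3\nu,3+2\nu\}$, $n\ge1$, and let $\mathtt{C}_{\theta}=\langle f_{\theta_1}(z),f_{\theta_2}(z),f_{\theta_3}(z),f_{\theta_4}(z)\rangle$ be a cyclic code of arbitrary length $n$ over $\mathtt{R}_{\theta}=Z_4+\nu Z_4$, $\nu^2=\theta$, where $f_{\theta_1}=f_{11}+2f_{12}+k_\theta f_{13}+2k_\theta f_{14}$, $f_{\theta_2}=2f_{22}+k_\theta f_{23}+2k_\theta f_{24}$, $f_{\theta_3}=k_\theta f_{33}+2k_\theta f_{34}$, $f_{\theta_4}=2k_\theta f_{44}$, with $f_{ij}(z)\in Z_2[z]/\langle z^n-1\rangle$ satisfying conditions (1)–(4) of the context (with $p_{ij}=f_{ij}$), and $f_{ii}$ the minimal degree polynomial generator of $\mathtt{C}_{\theta_i}$, $1\le i\le4$. Then there exists a set of generators $\{g_{\theta_1}(z),g_{\theta_2}(z),g_{\theta_3}(z),g_{\theta_4}(z)\}$ of $\mathtt{C}_\theta$, where $$g_{\theta_1}=g_{11}+2g_{12}+k_\theta g_{13}+2k_\theta g_{14},\quad g_{\theta_2}=2g_{22}+k_\theta g_{23}+2k_\theta g_{24},\quad g_{\theta_3}=k_\theta g_{33}+2k_\theta g_{34},\quad g_{\theta_4}=2k_\theta g_{44},$$ such that the polynomials $g_{ij}(z)\in Z_2[z]/\langle z^n-1\rangle$ satisfy conditions (1)–(4) of the context (with $p_{ij}=g_{ij}$), $g_{ii}(z)$ is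 the unique minimal degree polynomial generator of $\mathtt{C}_{\theta_i}$ for $1\le i\le4$, and either $g_{ij}(z)=0$ or $\deg g_{ij}(z)<\deg g_{jj}(z)$ for all $1\le i\le3$, $i<j\le4$.
   Context: For $\theta\in\mathtt{S}$, $\mathtt{R}_\theta=Z_4+\nu Z_4=\{a+b\nu: a,b\in Z_4\}$ is the commutative ring $Z_4[\nu]/\langle \nu^2-\theta\rangle$, where $Z_m$ denotes the integers modulo $m$. Define $k_\theta=\nu$ for $\theta\in\{0,\nu,2\nu,3\nu\}$, $k_\theta=1+\nu$ for $\theta\in\{1,3+2\nu\}$, and $k_\theta=2+\nu$ for $\theta\in\{2+\nu,2+3\nu\}$. A cyclic code of length $n$ over $\mathtt{R}_\theta$ is an $\mathtt{R}_\theta$-submodule of $\mathtt{R}_\theta^n$ closed under the cyclic shift $(s_0,\dots,s_{n-1})\mapsto(s_{n-1},s_0,\dots,s_{n-2})$; identifying $(s_0,\dots,s_{n-1})$ with $s_0+s_1z+\cdots+s_{n-1}z^{n-1}$, it is an ideal of $\mathtt{R}_\theta[z]/\langle z^n-1\rangle$. Angle brackets around polynomials denote the ideal generated in this ring. Binary polynomials are regarded as polynomials over $Z_4\subseteq\mathtt{R}_\theta$ by reading their coefficients as $0,1$. Conditions on a family of binary polynomials $p_{ij}$, $1\le i\le j\le4$ (divisibility in $Z_2[z]$): (1) $p_{22}\mid p_{11}\mid z^n-1$; (2) either $p_{12}=0$, or $p_{22}\mid p_{12}\frac{z^n-1}{p_{11}}$ with $\deg p_{22}>\deg p_{12}$;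 (3) $p_{44}\mid p_{33}\mid z^n-1$; (4) either $p_{34}=0$, or $p_{44}\mid p_{34}\frac{z^n-1}{p_{33}}$ with $\deg p_{44}>\deg p_{34}$. Associated to $\mathtt{C}_\theta$ are the following ideals of $Z_2[z]/\langle z^n-1\rangle$: $\mathtt{C}_{\theta_1}=\mathtt{C}_\theta \bmod (2,k_\theta)$; $\mathtt{C}_{\theta_2}=\{a(z): 2a(z)\in \mathtt{C}_\theta \bmod k_\theta\}$; $\mathtt{C}_{\theta_3}=\{a(z): k_\theta a(z)\in \mathtt{C}_\theta \bmod 2k_\theta\}$; $\mathtt{C}_{\theta_4}=\{a(z): 2k_\theta a(z)\in\mathtt{C}_\theta\}$ (with $a(z)$ binary). Equivalently, with $\mathrm{Res}(\mathtt{C}_\theta)=\{a\in Z_4[z]/\langle z^n-1\rangle: a+k_\theta b\in\mathtt{C}_\theta \text{ for some } b\in Z_4[z]/\langle z^n-1\rangle\}$ and $\mathrm{Tor}(\mathtt{C}_\theta)=\{a\in Z_4[z]/\langle z^n-1\rangle: k_\theta a\in\mathtt{C}_\theta\}$, $\mathtt{C}_{\theta_1},\mathtt{C}_{\theta_2}$ are the residue (reduction mod $2$) and torsion ($\{a: 2a\in\cdot\}$) codes of $\mathrm{Res}(\mathtt{C}_\theta)$, and $\mathtt{C}_{\theta_3},\mathtt{C}_{\theta_4}$ are those of $\mathrm{Tor}(\mathtt{C}_\theta)$. The minimal degree polynomial generator of $\mathtt{C}_{\theta_i}$ is the divisor of $z^n-1$ in $Z_2[z]$ generating it ($z^n-1$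 itself, of degree $n$, if the ideal is zero). *)

(* Defs.v *)
From HB Require Import structures.
From mathcomp Require Import all_boot all_order all_algebra.

Set Implicit Arguments.
Unset Strict Implicit.
Unset Printing Implicit Defensive.

Import GRing.Theory.
Local Open Scope ring_scope.

(* Elements of S, and k_theta, are given by polynomials over Z_4 of degree at *)
(* most 1 in which 'X stands for nu; this avoids the circularity of theta     *)
(* being an element of the ring that it defines.                              *)
Definition thetas : seq {poly 'Z_4} :=
  [:: 0; 1; 'X; 2 *: 'X; 3 *: 'X; 2 + 'X; 2 + 3 *: 'X; 3 + 2 *: 'X].

Definition kpoly (theta : {poly 'Z_4}) : {poly 'Z_4} :=
  if theta \in [:: 1; 3 + 2 *: 'X] then 1 + 'X
  else if theta \in [:: 2 + 'X; 2 + 3 *: 'X] then 2 + 'X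
  else 'X.

Definition Rtheta (theta : {poly 'Z_4}) : comNzRingType :=
  {poly %/ ('X^2 - theta)}.

(* A[z]/<z^n - 1>; meaningful for 0 < n, the modulus of {poly %/ _} being     *)
(* replaced by 'X when it is constant.                                        *)
Definition cycring (A : comNzRingType) (n : nat) : comNzRingType :=
  {poly %/ ('X^n - 1 : {poly A})}.

Definition to_cycring (A : comNzRingType) (n : nat) (p : {poly A}) :
  cycring A n := in_qpoly ('X^n - 1) p.

Definition kelt (theta : {poly 'Z_4}) (n : nat) : cycring (Rtheta theta) n :=
  to_cycring n (in_qpoly ('X^2 - theta) (kpoly theta))%:P.

(* Not additive: the coefficients of the representative of degree < n are     *)
(* read as the integers 0, 1.                                                 *)
Definition lift_cyc (theta : {poly 'Z_4}) (n : nat) (a : cycring 'F_2 n) :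
  cycring (Rtheta theta) n :=
  to_cycring n
    (map_poly (fun b : 'F_2 => (nat_of_ord b)%:R : Rtheta theta) (val a)).

(* The polynomial is first reduced modulo z^n - 1 in Z_2[z], so the generator *)
(* z^n - 1 of the zero ideal is sent to 0 (and not to z^n + 1 = 2).           *)
Definition lift_poly (theta : {poly 'Z_4}) (n : nat) (p : {poly 'F_2}) :
  cycring (Rtheta theta) n := lift_cyc theta (to_cycring n p).

Definition ideal_gen (A : comNzRingType) (s : seq A) (x : A) : Prop :=
  exists c : 'I_(size s) -> A, x = \sum_(i < size s) c i * s`_i.

Definition cyclic_shift (A : comNzRingType) (n : nat) (s : 'rV[A]_n) :
  'rV[A]_n := \row_(i < n) s 0 (ord_pred i).

Definition cyclic_code (A : comNzRingType) (n : nat) (C : {pred 'rV[A]_n}) :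
  Prop :=
  submod_closed C /\ (forall s, s \in C -> cyclic_shift s \in C).

Definition code_poly (A : comNzRingType) (n : nat) (C : {pred 'rV[A]_n})
  (q : cycring A n) : Prop :=
  exists2 s, s \in C & q = to_cycring n (rVpoly s).

Section AssociatedIdeals.

Variables (theta : {poly 'Z_4}) (n : nat).
Variable C : {pred 'rV[Rtheta theta]_n}.
Local Notation k := (kelt theta n).
Local Notation lft := (lift_cyc theta).

Definition assoc1 (a : cycring 'F_2 n) : Prop :=
  exists u v, code_poly C (lft a + 2 * u + k * v).

Definition assoc2 (a : cycring 'F_2 n) : Prop :=
  exists v, code_poly C (2 * lft a + k * v).

Definition assoc3 (a : cycring 'F_2 n) : Prop :=
  exists v, code_poly C (k * lft a + 2 * k * v).

Definition assoc4 (a : cycring 'F_2 n) : Prop :=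
  code_poly C (2 * k * lft a).

Definition assoc (i : nat) : cycring 'F_2 n -> Prop :=
  match i with
  | 1 => assoc1
  | 2 => assoc2
  | 3 => assoc3
  | _ => assoc4
  end%N.

End AssociatedIdeals.

(* For the zero ideal this forces g = 'X^n - 1. *)
Definition min_deg_gen (n : nat) (I : cycring 'F_2 n -> Prop)
  (g : {poly 'F_2}) : Prop :=
  g %| 'X^n - 1 /\ (forall a, I a <-> ideal_gen [:: to_cycring n g] a).

(* Families p_ij, 1 <= i <= j <= 4; the values at other indices are unused.   *)
Definition bin_family := nat -> nat -> {poly 'F_2}.

(* Off the diagonal, p_ij is the representative of degree < n of a class      *)
(* modulo z^n - 1; the p_ii are allowed to be z^n - 1 itself.                 *)
Definition reduced_family (n : nat) (p : bin_family) : Prop :=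
  forall i j : nat, (1 <= i)%N -> (i < j)%N -> (j <= 4)%N ->
    (size (p i j) <= n)%N.

Definition pair_conditions (n : nat) (pii pij pjj : {poly 'F_2}) : Prop :=
  [/\ pjj %| pii, pii %| 'X^n - 1
    & pij = 0 \/
      (pjj %| pij * (('X^n - 1) %/ pii) /\ (size pij < size pjj)%N)].

Definition conditions (n : nat) (p : bin_family) : Prop :=
  pair_conditions n (p 1%N 1%N) (p 1%N 2%N) (p 2%N 2%N) /\
  pair_conditions n (p 3%N 3%N) (p 3%N 4%N) (p 4%N 4%N).

Definition code_gens (theta : {poly 'Z_4}) (n : nat) (p : bin_family) :
  seq (cycring (Rtheta theta) n) :=
  let k := kelt theta n in
  let L i j := lift_poly theta n (p i j) in
  [:: L 1%N 1%N + 2 * L 1%N 2%N + k * L 1%N 3%N + 2 * k * L 1%N 4%N;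
      2 * L 2%N 2%N + k * L 2%N 3%N + 2 * k * L 2%N 4%N;
      k * L 3%N 3%N + 2 * k * L 3%N 4%N;
      2 * k * L 4%N 4%N].

(* Main.v *)
(* Keep f12, f34 and the diagonal, and divide f13, f23 by f33, then the last  *)
(* coordinates by f44, in Z_2[z]: this subtracts multiples of f_theta3 and    *)
(* f_theta4 from f_theta1 and f_theta2, so the ideal is unchanged. Reading    *)
(* binary coefficients in Z_4 is additive and multiplicative only up to       *)
(* multiples of 2; the resulting error is a multiple of 2 k, and since 4 = 0  *)
(* it only matters modulo 2.                                                  *)

Require Import Defs.
From HB Require Import structures.
From mathcomp Require Import all_boot all_order all_algebra.
From mathcomp Require Import ring.

Import GRing.Theory.
Local Open Scope ring_scope.

(** The theorem is Euclidean division carried out through a lift that is not additive. The relation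
    [lifts x p] says that [x] has a [Z_4] representative congruent to [p] modulo 2 and [z^n - 1];
    unlike [lift_poly], it respects sums, products and opposites. Two lifts of one [p] differ by an
    even element ([lifts_eq_mod2]), so they agree once doubled ([lifts_double]). Hence a division in
    [Z_2[z]] gives an identity in the code ring up to a carry, which [reduce_tail] moves into the
    [2k] coordinate, where carries vanish. The diagonal is kept, and a generator dividing [z^n - 1]
    is unique. *)

Definition mod2 (a : 'Z_4) : 'F_2 := (nat_of_ord a)%:R.

Fact mod2_zmod_morphism : zmod_morphism mod2.
Proof.
by case=> [[|[|[|[|?]]]] ?] [[|[|[|[|?]]]] ?] //; apply/val_inj.
Qed.

Fact mod2_monoid_morphism : monoid_morphism mod2.
Proof.
split; first exact: val_inj.
by case=> [[|[|[|[|?]]]] ?] [[|[|[|[|?]]]] ?] //; apply/val_inj.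
Qed.

HB.instance Definition _ :=
  GRing.isZmodMorphism.Build 'Z_4 'F_2 mod2 mod2_zmod_morphism.
HB.instance Definition _ :=
  GRing.isMonoidMorphism.Build 'Z_4 'F_2 mod2 mod2_monoid_morphism.

Definition lift01 (b : 'F_2) : 'Z_4 := (nat_of_ord b)%:R.

Lemma lift01K : cancel lift01 mod2.
Proof. by case=> [[|[|?]] ?] //; apply/val_inj. Qed.

Lemma mod2_eq0 (a : 'Z_4) : mod2 a = 0 -> exists b : 'Z_4, a = 2 * b.
Proof.
case: a => [[|[|[|[|?]]]] ?] // => [_|_]; last by exists 1; apply/val_inj.
by exists 0; apply/val_inj.
Qed.

Lemma map_lift01K : cancel (map_poly lift01) (map_poly mod2).
Proof.
by move=> p; apply/polyP=> i; rewrite coef_map /= coef_map_id0 ?lift01K.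
Qed.

Lemma map_mod2_eq0 (P : {poly 'Z_4}) :
  map_poly mod2 P = 0 -> exists Q, P = 2 * Q.
Proof.
move=> P0.
have half i : exists b : 'Z_4, P`_i == 2 * b.
  have /mod2_eq0[b ->] : mod2 P`_i = 0 by rewrite -coef_map P0 coef0.
  by exists b.
exists (\poly_(i < size P) xchoose (half i)); apply/polyP=> i.
rewrite mulr_natl coefMn coef_poly; case: ltnP => [_|/(nth_default 0) ->].
  by rewrite -[RHS]mulr_natl; apply/eqP/(xchooseP (half i)).
by rewrite mul0rn.
Qed.

Lemma mk_monic_Xn_sub_1 (A : comNzRingType) n :
  (0 < n)%N -> mk_monic ('X^n - 1 : {poly A}) = 'X^n - 1.
Proof.
by move=> n_gt0; rewrite /mk_monic size_XnsubC // ltnS n_gt0 monicXnsubC.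
Qed.

Lemma val_to_cycring n (p : {poly 'F_2}) :
  (0 < n)%N -> val (to_cycring n p) = p %% ('X^n - 1).
Proof.
move=> n_gt0; rewrite /= mk_monic_Xn_sub_1 //.
by rewrite Pdiv.IdomainMonic.modpE // monicXnsubC.
Qed.

Section Lifting.

Variables (B : comNzRingType) (j : {rmorphism 'Z_4 -> B}) (n : nat).
Hypothesis n_gt0 : (0 < n)%N.

Local Notation A := (cycring B n).
Local Notation M := ('X^n - 1).

Definition cyc_map : {poly 'Z_4} -> A := in_qpoly ('X^n - 1) \o map_poly j.

HB.instance Definition _ := GRing.RMorphism.on cyc_map.

Definition lifts (x : A) (p : {poly 'F_2}) : Prop :=
  exists2 P, x = cyc_map P & M %| map_poly mod2 P - p.

Lemma lifts_add x y p q : lifts x p -> lifts y q -> lifts (x + y) (p + q).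
Proof.
move=> [P -> hP] [Q -> hQ]; exists (P + Q); first by rewrite rmorphD.
by rewrite rmorphD opprD addrACA dvdp_add.
Qed.

Lemma lifts_mul x y p q : lifts x p -> lifts y q -> lifts (x * y) (p * q).
Proof.
move=> [P -> hP] [Q -> hQ]; exists (P * Q); first by rewrite rmorphM.
rewrite rmorphM /=.
set P2 := map_poly _ P in hP *; set Q2 := map_poly _ Q in hQ *.
have -> : P2 * Q2 - p * q = P2 * (Q2 - q) + q * (P2 - p) by ring.
by rewrite dvdp_add ?dvdp_mull.
Qed.

Lemma lifts_opp x p : lifts x p -> lifts (- x) (- p).
Proof.
move=> [P -> hP]; exists (- P); first by rewrite rmorphN.
by rewrite rmorphN -opprD dvdpNr.
Qed.

Lemma cyc_map_Xn_sub_1 : cyc_map M = 0.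
Proof.
rewrite /cyc_map /= rmorphB rmorph1 /= map_polyXn; apply/val_inj => /=.
by rewrite mk_monic_Xn_sub_1 // Pdiv.RingMonic.rmodpp // monicXnsubC.
Qed.

(** The representatives differ modulo 2 by [t * (z^n - 1)]. Lifting [t] and subtracting that
    multiple, which vanishes in the quotient, leaves a polynomial with even coefficients. *)
Lemma lifts_eq_mod2 x y p :
  lifts x p -> lifts y p -> exists z q, lifts z q /\ x = y + 2 * z.
Proof.
move=> [P -> hP] [Q -> hQ].
have /dvdpP[t Et] : M %| map_poly mod2 (P - Q).
  rewrite rmorphB /=; set P2 := map_poly _ P in hP *.
  set Q2 := map_poly _ Q in hQ *.
  have -> : P2 - Q2 = (P2 - p) - (Q2 - p) by ring.
  exact: dvdp_sub.
have [|S ES] := map_mod2_eq0 (P - Q - map_poly lift01 t * M).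
  rewrite rmorphB rmorphM /= Et (rmorphB (map_poly mod2)) rmorph1 /= map_polyXn.
  by rewrite map_lift01K subrr.
exists (cyc_map S), (map_poly mod2 S); split.
  by exists S; rewrite // subrr dvdp0.
have -> : P = Q + (map_poly lift01 t * M + 2 * S) by rewrite -ES; ring.
by rewrite 2!rmorphD 2!rmorphM /= cyc_map_Xn_sub_1 mulr0 add0r rmorph_nat.
Qed.

Lemma four_eq0 : 4 = 0 :> A.
Proof.
rewrite -(rmorph_nat cyc_map) -polyC_natr (_ : 4 = 0) ?rmorph0 //.
exact: val_inj.
Qed.

Lemma lifts_double x y p : lifts x p -> lifts y p -> 2 * x = 2 * y.
Proof.
move=> hx hy; have [z [q [_ ->]]] := lifts_eq_mod2 x y p hx hy.
by rewrite mulrDr mulrA -natrM four_eq0 mul0r addr0.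
Qed.

(* Dividing by the (3,3) entry leaves a carry in 2 k A, which is absorbed     *)
(* into the last coordinate before dividing by the (4,4) entry.               *)
Lemma reduce_tail (L : {poly 'F_2} -> A) (k : A)
    (f33 f34 f44 p q : {poly 'F_2}) :
    (forall r, lifts (L r) r) -> f33 != 0 -> f44 != 0 ->
  exists r s : {poly 'F_2}, [/\ (size r < size f33)%N, (size s < size f44)%N
    & exists c d, k * L p + 2 * k * L q = k * L r + 2 * k * L s
        + (c * (k * L f33 + 2 * k * L f34) + d * (2 * k * L f44))].
Proof.
move=> hL f33_neq0 f44_neq0.
have hr : lifts (L p - L (p %/ f33) * L f33) (p %% f33).
  have -> : p %% f33 = p - p %/ f33 * f33 by rewrite {2}(divp_eq p f33); ring.
  by apply: lifts_add => //; apply: lifts_opp; apply: lifts_mul.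
have [z [t [hz Ep]]] := lifts_eq_mod2 _ _ _ hr (hL _).
(* The new [2k] coordinate: the old one, plus the carry [t], minus what the multiple of the third
   generator contributes. *)
set u := q + t - p %/ f33 * f34.
have hu : lifts (L q + z - L (p %/ f33) * L f34) u.
  apply: lifts_add; first exact: lifts_add.
  by apply: lifts_opp; apply: lifts_mul.
have hu' : lifts (L (u %/ f44) * L f44 + L (u %% f44)) u.
  rewrite [X in lifts _ X](divp_eq u f44).
  by apply: lifts_add => //; apply: lifts_mul.
have Eu := lifts_double _ _ _ hu hu'.
exists (p %% f33), (u %% f44); split; rewrite ?ltn_modp //.
exists (L (p %/ f33)), (L (u %/ f44)).
have -> : L p = L (p %/ f33) * L f33 + (L (p %% f33) + 2 * z).
  by rewrite -Ep; ring.
apply/eqP; rewrite -subr_eq0; apply/eqP.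
(* The [k] terms cancel; what remains is [k] times the difference of two doubled lifts of [u]. *)
transitivity (k * (2 * (L q + z - L (p %/ f33) * L f34)
   - 2 * (L (u %/ f44) * L f44 + L (u %% f44)))); first by ring.
by rewrite Eu subrr mulr0.
Qed.

End Lifting.

(** Reducing [p] before lifting changes it by a multiple of [z^n - 1], which [lifts] tolerates. *)
Lemma lift_poly_lifts theta n p : (0 < n)%N ->
  lifts _ (in_qpoly ('X^2 - theta) \o polyC) n (lift_poly theta n p) p.
Proof.
move=> n_gt0; exists (map_poly lift01 (p %% ('X^n - 1))).
  rewrite /lift_poly /lift_cyc val_to_cycring // /to_cycring /cyc_map /=.
  congr (in_qpoly _ _); apply/polyP => i.
  rewrite coef_map_id0 // coef_map /= coef_map_id0 // /lift01.
  by rewrite polyC_natr rmorph_nat.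
rewrite map_lift01K {2}(divp_eq p ('X^n - 1)) opprD addrCA subrr addr0.
by rewrite dvdpNr dvdp_mull.
Qed.

Lemma ideal_gen4 (A : comNzRingType) (x1 x2 x3 x4 q : A) :
  ideal_gen [:: x1; x2; x3; x4] q <->
  exists c1 c2 c3 c4, q = c1 * x1 + c2 * x2 + c3 * x3 + c4 * x4.
Proof.
split=> [[c ->]|[c1 [c2 [c3 [c4 ->]]]]].
  exists (c (inord 0)), (c (inord 1)), (c (inord 2)), (c (inord 3)).
  rewrite !big_ord_recl big_ord0 /= addr0 !addrA.
  by do !congr (_ + _); congr (c _ * _); apply/val_inj; rewrite /= inordK.
exists (fun i => [:: c1; c2; c3; c4]`_i).
by rewrite !big_ord_recl big_ord0 /= addr0 !addrA.
Qed.

(** The change of generators is unitriangular, hence invertible. *)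
Lemma ideal_gen_tail_reduction (A : comNzRingType) (x1 x2 y1 y2 x3 x4 q : A) :
    (exists c d, x1 = y1 + (c * x3 + d * x4)) ->
    (exists c d, x2 = y2 + (c * x3 + d * x4)) ->
  ideal_gen [:: x1; x2; x3; x4] q <-> ideal_gen [:: y1; y2; x3; x4] q.
Proof.
move=> [c [d ->]] [c' [d' ->]]; rewrite !ideal_gen4.
split=> -[a1 [a2 [a3 [a4 ->]]]]; exists a1, a2.
  by exists (a3 + a1 * c + a2 * c'), (a4 + a1 * d + a2 * d'); ring.
by exists (a3 - a1 * c - a2 * c'), (a4 - a1 * d - a2 * d'); ring.
Qed.

Lemma monic_F2 (p : {poly 'F_2}) : p != 0 -> p \is monic.
Proof.
rewrite -lead_coef_eq0 monicE.
by case: (lead_coef p) => [[|[|?]] ?].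
Qed.

(** The class of [h] is a multiple of that of [g]; since [g] divides [z^n - 1], divisibility by [g]
    can be tested on classes. *)
Lemma min_deg_gen_dvdp n (I : cycring 'F_2 n -> Prop) (g h : {poly 'F_2}) :
  (0 < n)%N -> min_deg_gen I g -> min_deg_gen I h -> g %| h.
Proof.
move=> n_gt0 [dvd_g genI_g] [_ genI_h].
have : I (to_cycring n h).
  apply/genI_h; exists (fun=> 1).
  by rewrite big_ord_recl big_ord0 addr0 mul1r.
case/genI_g => c; rewrite big_ord_recl big_ord0 addr0 /=.
set d := c _ => /(congr1 val); rewrite val_to_cycring // => Eh.
have : g %| h %% ('X^n - 1).
  rewrite Eh /=; move: (polyn _) => e.
  rewrite mk_monic_Xn_sub_1 // -!Pdiv.IdomainMonic.modpE ?monicXnsubC //.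
  by rewrite -(dvdp_mod _ dvd_g) dvdp_mull // -(dvdp_mod _ dvd_g).
by rewrite -(dvdp_mod _ dvd_g).
Qed.

Lemma min_deg_gen_neq0 n (I : cycring 'F_2 n -> Prop) (g : {poly 'F_2}) :
  (0 < n)%N -> min_deg_gen I g -> g != 0.
Proof.
by move=> n_gt0 [/dvdpN0 g_neq0 _]; rewrite g_neq0 ?monic_neq0 ?monicXnsubC.
Qed.

Lemma min_deg_gen_unique n (I : cycring 'F_2 n -> Prop) (g h : {poly 'F_2}) :
  (0 < n)%N -> min_deg_gen I g -> min_deg_gen I h -> g = h.
Proof.
move=> n_gt0 Hg Hh; apply/eqP; rewrite -eqp_monic.
- by rewrite /eqp !(min_deg_gen_dvdp _ I).
- exact/monic_F2/(min_deg_gen_neq0 _ I).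
- exact/monic_F2/(min_deg_gen_neq0 _ I).
Qed.

Theorem theorem3p2 (theta : {poly 'Z_4}) (n : nat)
    (C : {pred 'rV[Rtheta theta]_n}) (f : bin_family) :
  theta \in thetas ->
  (0 < n)%N ->
  cyclic_code C ->
  (forall q, code_poly C q <-> ideal_gen (code_gens theta n f) q) ->
  reduced_family n f ->
  conditions n f ->
  (forall i : nat, (1 <= i <= 4)%N -> min_deg_gen (assoc C i) (f i i)) ->
  exists g : bin_family,
    [/\ forall q, code_poly C q <-> ideal_gen (code_gens theta n g) q,
        reduced_family n g,
        conditions n g,
        forall i : nat, (1 <= i <= 4)%N ->
          min_deg_gen (assoc C i) (g i i) /\
          (forall h, min_deg_gen (assoc C i) h -> h = g i i)
      & forall i j : nat, (1 <= i <= 3)%N -> (i < j <= 4)%N ->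
          g i j = 0 \/ (size (g i j) < size (g j j))%N].
Proof.
move=> _ n_gt0 _ genC red_f [cond12 cond34] min_f.
have f_neq0 i : (1 <= i <= 4)%N -> f i i != 0.
  by move=> /min_f/min_deg_gen_neq0; apply.
have red p q := reduce_tail _ _ n n_gt0 (lift_poly theta n) (kelt theta n)
  (f 3 3)%N (f 3 4)%N (f 4 4)%N p q
  (fun r => lift_poly_lifts theta n r n_gt0) (f_neq0 3 isT) (f_neq0 4 isT).
have [r13 [r14 [s13 s14 E1]]] := red (f 1 3)%N (f 1 4)%N.
have [r23 [r24 [s23 s24 E2]]] := red (f 2 3)%N (f 2 4)%N.
have size_f i : (1 <= i <= 4)%N -> (size (f i i) <= n.+1)%N.
  move=> /min_f[dvd_f _]; rewrite -(@size_XnsubC 'F_2 n 1) //.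
  by apply: dvdp_leq => //; rewrite monic_neq0 ?monicXnsubC.
have le3 r : (size r < size (f 3 3))%N -> (size r <= n)%N.
  by move=> ltr; rewrite -ltnS (leq_trans ltr) ?size_f.
have le4 r : (size r < size (f 4 4))%N -> (size r <= n)%N.
  by move=> ltr; rewrite -ltnS (leq_trans ltr) ?size_f.
exists (fun i j => match i, j with
  | 1, 3 => r13 | 1, 4 => r14 | 2, 3 => r23 | 2, 4 => r24 | _, _ => f i j
  end)%N; split.
- move=> q; rewrite genC; apply: ideal_gen_tail_reduction.
    by have [c [d Ecd]] := E1; exists c, d; rewrite -!addrA Ecd !addrA.
  by have [c [d Ecd]] := E2; exists c, d; rewrite -!addrA Ecd !addrA.
- move=> i j i_gt0 lt_ij le_j4; have := red_f i j i_gt0 lt_ij le_j4.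
  by case: i j i_gt0 lt_ij le_j4 => [|[|[|[|[|?]]]]] [|[|[|[|[|?]]]]] //; auto.
(* These conditions involve only entries kept from [f]. *)
- by [].
- move=> i /[dup] i_le4 /min_f; case: i i_le4 => [|[|[|[|[|?]]]]] // _ Hf;
    by split=> // h Hh; apply: min_deg_gen_unique Hh Hf.
(* The bounds for (1,2) and (3,4) are part of the conditions on [f]; the other four are remainder
   bounds. *)
- move=> i j; have [_ _ H12] := cond12; have [_ _ H34] := cond34.
  case: i j => [|[|[|[|?]]]] [|[|[|[|[|?]]]]] //= _ _; auto.
  + by case: H12 => [->|[]]; auto.
  + by case: H34 => [->|[]]; auto.
Qed.
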